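(* Let $n,m\ge 2$ and let $(a_{i,j})_{(i,j)\in\mathbb{Z}^2}$ be an array such that $a_{i,j}a_{i+1,j+1}-a_{i,j+1}a_{i+1,j}=1$ for all $i,j$, $a_{i,j+n}=-a_{i,j}$ and $a_{i+m,j}=-a_{i,j}$ for all $i,j$, and $a_{i,j}$ is a positive integer for $0\le i\le m-1$, $0\le j\le n-1$. Let $q=(q_j)$ ($n$-periodic) and $q'=(q'_i)$ ($m$-periodic) be the sequences such that $a_{i,j+1}=q_ja_{i,j}-a_{i,j-1}$ and $a_{i+1,j}=q'_ia_{i,j}-a_{i-1,j}$ for all $i,j$, and write $a=a_{0,0}$, $b=a_{0,1}$, $c=a_{1,0}$, $d=a_{1,1}$. Let $(v_0,\ldots,v_{n-1})$ be a Farey $n$-gon with $v_0=\frac{a}{c}$, $v_1=\frac{b}{d}$, such that for each $j$ the number of triangles incident to $v_j$ equals $q_j$; and let $(v'_0,\ldots,v'_{m-1})$ be a Farey $m$-gon with $v'_0=\frac10$, $v'_{m-1}=\frac01$, such that for each $i$ the number of triangles incident to $v'_i$ equals $q'_{i+1}$ (indices of $q'$ taken mod $m$). Setting $v'_{-1}:=v'_{m-1}$, one has $$a_{i,j}=d(v'_{i-1},v_j)\qquad\text{for all }0\le i\le m-1,\ 0\le j\le n-1.$$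
   Context: Elements of $\mathbb{Q}\cup\{\infty\}$ are written as irreducible fractions $\frac{p}{r}$ with $r\ge 0$, with $\infty=\frac10$. The Farey distance is $d(\frac{p_1}{r_1},\frac{p_2}{r_2})=|p_1r_2-p_2r_1|$. The Farey graph has vertex set $\mathbb{Q}\cup\{\infty\}$, with an edge between $v_1,v_2$ iff $d(v_1,v_2)=1$. A Farey $n$-gon is a sequence of rationals (or $\infty$) with $\infty\ge v_0>v_1>\cdots>v_{n-1}\ge 0$ such that $v_i,v_{i+1}$ (for $0\le i\le n-2$) and $v_{n-1},v_0$ are joined by edges of the Farey graph. The number of triangles incident to a vertex $v_i$ of a Farey $n$-gon is (the number of vertices $v_k$, $k\ne i$, of the polygon joined to $v_i$ by an edge of the Farey graph) minus $1$; this is the number of triangles at $v_i$ in the triangulation of the polygon given by the Farey edges among its vertices. *)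

(* Defs.v *)
From mathcomp Require Import all_boot all_order all_algebra.
Set Implicit Arguments.
Unset Strict Implicit.
Unset Printing Implicit Defensive.
Import Order.TTheory GRing.Theory Num.Theory.
Local Open Scope ring_scope.

(* The rationals with one point at infinity: [None] is 1/0. *)
Definition qinf : Type := option rat.

Definition qinf_num (x : qinf) : int := if x is Some u then numq u else 1.
Definition qinf_den (x : qinf) : int := if x is Some u then denq u else 0.

Definition qinf_lt (x y : qinf) : bool :=
  match x, y with
  | Some u, Some v => u < v
  | Some _, None => true
  | None, _ => false
  end.

Definition qinf_le (x y : qinf) : bool :=
  match x, y with
  | Some u, Some v => u <= v
  | _, None => true
  | None, Some _ => false
  end.

Definition farey_dist (x y : qinf) : int :=
  `|qinf_num x * qinf_den y - qinf_num y * qinf_den x|.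

Definition farey_edge (x y : qinf) : bool := farey_dist x y == 1.

(* Only the values v 0, ..., v n.-1 matter. *)
Definition farey_gon (n : nat) (v : nat -> qinf) : Prop :=
  [/\ qinf_le (v 0%N) None,
      forall i : nat, (i.+1 < n)%N -> qinf_lt (v i.+1) (v i),
      qinf_le (Some 0) (v n.-1),
      forall i : nat, (i.+1 < n)%N -> farey_edge (v i) (v i.+1)
    & farey_edge (v n.-1) (v 0%N)].

(* The subtraction is taken in int, so it is not truncated. *)
Definition farey_triangles (n : nat) (v : nat -> qinf) (i : nat) : int :=
  #|[set k : 'I_n | (k != i :> nat) && farey_edge (v k) (v i)]|%:Z - 1.

(* Main.v *)
Require Import Defs.
From mathcomp Require Import all_boot all_order all_algebra.
From mathcomp Require Import zify ring.
Import Order.TTheory GRing.Theory Num.Theory.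
Local Open Scope ring_scope.

(** Write the vertices of a Farey [n]-gon as integer vectors [W k = (num, den)],
    extended by [W (k + n) = - W k].  Consecutive vectors have determinant [1],
    so [W (j + 1) = c W j - W (j - 1)] with [c = det (W (j - 1), W (j + 1))].
    Write [W k = Y k W j - X k W (j - 1)].  The fractions [Y k / X k] decrease
    from [c] to [0] along Farey edges as [k] runs from [j + 1] to [j + n - 1];
    the floor drops by one exactly when leaving an integer, that is a neighbour
    of [W j], so [c] is the number of triangles at [j].  Hence [a i j] obeys in
    [j] the recurrence of the first polygon and in [i] that of the second, and
    its entries are determinants of vectors of the two polygons. *)

(* Antiperiodic only for indices below [2 n]. *)
Definition antiper (n : nat) (f : nat -> int) (k : nat) : int :=
  if (k < n)%N then f k else - f (k - n)%N.

Lemma antiper_lt n f k : (k < n)%N -> antiper n f k = f k.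
Proof. by rewrite /antiper => ->. Qed.

Lemma antiperD n f k : antiper n f (k + n)%N = - f k.
Proof. by rewrite /antiper ltnNge leq_addl /= addnK. Qed.

Definition qinf_det (x y : qinf) : int :=
  qinf_num x * qinf_den y - qinf_num y * qinf_den x.

Lemma qinf_lt_trans (y x z : qinf) : qinf_lt x y -> qinf_lt y z -> qinf_lt x z.
Proof.
by case: x y z => [x|] [y|] [z|] //=; apply: lt_trans.
Qed.

Lemma qinf_det_gt0 (x y : qinf) : qinf_lt y x -> 0 < qinf_det x y.
Proof.
case: x y => [x|] [y|] //=; rewrite /qinf_det /=; last first.
  by move=> _; rewrite mulr0 subr0 mul1r denq_gt0.
rewrite -{1}(divq_num_den x) -{1}(divq_num_den y).
rewrite ltr_pdivlMr ?ltr0z ?denq_gt0 // mulrAC.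
rewrite ltr_pdivrMr ?ltr0z ?denq_gt0 // -!intrM ltr_int.
by rewrite subr_gt0.
Qed.

(** * Floors of fractions along a Farey path *)

(** No integer lies strictly between two Farey neighbours, so the floor drops only on leaving an
    integer, that is when [X] is 1, and then by exactly one. *)
Lemma divz_farey_step (X Y X' Y' : int) : 0 < X -> 0 < X' ->
  Y * X' - Y' * X = 1 -> (Y %/ X)%Z = (Y' %/ X')%Z + (X == 1).
Proof.
move=> X_gt0 X'_gt0 YX1.
have Y_eq := divz_eq Y X; have r_ge0 := modz_ge0 Y (lt0r_neq0 X_gt0).
have r_lt := ltz_pmod Y X_gt0.
have Y'_eq := divz_eq Y' X'; have r'_ge0 := modz_ge0 Y' (lt0r_neq0 X'_gt0).
have r'_lt := ltz_pmod Y' X'_gt0.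
move: (Y %/ X)%Z (Y %% X)%Z (Y' %/ X')%Z (Y' %% X')%Z
  => f r f' r' in Y_eq r_ge0 r_lt Y'_eq r'_ge0 r'_lt *.
have key : (f - f') * (X * X') = 1 + r' * X - r * X' by rewrite -YX1 Y_eq Y'_eq; ring.
case: eqP => [X1 | X1].
  have {r_ge0 r_lt}r0 : r = 0 by lia.
  rewrite X1 r0 mul1r mul0r mulr1 in key.
  by nia.
have r'X : r' * X <= (X' - 1) * X by rewrite ler_pM2r //; lia.
have rX' : r * X' <= (X - 1) * X' by rewrite ler_pM2r //; lia.
(* As [X <> 1], [r = 0] would make [X] divide 1. Otherwise the right side of [key] lies strictly
   between [- (X * X')] and [X * X'], which forces [f = f']. *)
have [r0 | r_gt0] : r = 0 \/ 1 <= r by lia.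
  have : (X %| 1)%Z.
    apply/dvdzP; exists ((f - f') * X' - r').
    by rewrite mulrBl -mulrA (mulrC X') key r0; ring.
  by rewrite dvdz1; lia.
have rX1 : X' <= r * X' by rewrite ler_peMl // ltW.
have XX'_gt0 : 0 < X * X' by rewrite mulr_gt0.
have r'X_ge0 : 0 <= r' * X by rewrite mulr_ge0 // ltW.
have le1 : (f - f') * (X * X') < 1 * (X * X') by rewrite key; lia.
have ge1 : (-1) * (X * X') < (f - f') * (X * X') by rewrite key; lia.
rewrite !ltr_pM2r // in le1 ge1.
by lia.
Qed.

Lemma farey_path_count (N : nat) (X Y : nat -> int) :
  (forall k, (k <= N)%N -> 0 < X k) ->
  (forall k, (k < N)%N -> Y k * X k.+1 - Y k.+1 * X k = 1) ->
  (Y 0%N %/ X 0%N)%Z = (Y N %/ X N)%Z + (\sum_(k < N) (X k == 1))%N.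
Proof.
elim: N => [|N IHN] X_gt0 YX1; first by rewrite big_ord0 addr0.
rewrite big_ord_recr /= IHN; last 2 first.
- by move=> k kN; apply: X_gt0; apply: leqW.
- by move=> k kN; apply: YX1; apply: leqW.
rewrite (divz_farey_step _ _ (X N.+1) (Y N.+1)) ?X_gt0 ?YX1 //.
by rewrite PoszD -addrA; congr (_ + _); rewrite addrC.
Qed.

(** * Determinants and recurrences in one Farey polygon *)

Section FareyGon.
Variables (n : nat) (v : nat -> qinf).
Hypotheses (n_ge2 : (2 <= n)%N) (v_gon : farey_gon n v).

Let P := antiper n (qinf_num \o v).
Let R := antiper n (qinf_den \o v).
Let D i k := P i * R k - P k * R i.

Lemma gon_lt i k : (i < k)%N -> (k < n)%N -> qinf_lt (v k) (v i).
Proof.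
case: v_gon => _ v_lt _ _ _.
elim: k => // k IHk; rewrite ltnS leq_eqVlt => /orP[/eqP-> | ik] kn.
  exact: v_lt.
exact: qinf_lt_trans (v_lt k kn) (IHk ik (ltnW kn)).
Qed.

(** From index [n] on, the order relative to [v i] is reversed; the sign in [antiper] makes up for
    it. *)
Lemma gon_det_gt0 i k : (i < n)%N -> (i < k < i + n)%N -> 0 < D i k.
Proof.
move=> i_n /andP[ik kin]; rewrite /D /P /R !(antiper_lt _ _ i) //=.
have [kn | nk] := ltnP k n.
  by rewrite !antiper_lt //; apply: qinf_det_gt0; apply: gon_lt.
rewrite -(subnK nk) !antiperD /=.
have /qinf_det_gt0 : qinf_lt (v i) (v (k - n)%N) by apply: gon_lt; lia.
by rewrite /qinf_det; congr (0 < _); ring.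
Qed.

Lemma gon_det_succ i : (i < n)%N -> D i i.+1 = 1.
Proof.
move=> i_n; have : 0 < D i i.+1 by apply: gon_det_gt0; lia.
case: v_gon => _ _ _ edge edge0.
rewrite /D /P /R !(antiper_lt _ _ i) //=.
have [kn | nk] := ltnP i.+1 n.
  rewrite !antiper_lt //=; have := edge i kn.
  by rewrite /farey_edge /farey_dist => /eqP <- /gtr0_norm ->.
have ->: i.+1 = (0 + n)%N by lia.
have ->: i = n.-1 by lia.
rewrite !antiperD /=; move: edge0.
rewrite /farey_edge /farey_dist => /eqP <- /gtr0_norm {1}<-.
by rewrite -normrN; congr `|_|; ring.
Qed.

Lemma gon_det_succ2 i : (i < n + n.-1)%N -> D i i.+1 = 1.
Proof.
move=> lt_i; have [i_n | n_i] := ltnP i n; first exact: gon_det_succ.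
move: lt_i; rewrite -(subnK n_i); move: (i - n)%N => k lt_k.
have k_n : (k.+1 < n)%N by lia.
have := gon_det_succ _ (ltnW k_n); rewrite /D /P /R.
rewrite -addSn !antiperD !antiper_lt ?(ltnW k_n) //=.
by rewrite !mulrNN.
Qed.

Lemma gon_detDr i k : (k < n)%N -> D i (k + n) = - D i k.
Proof. by move=> k_n; rewrite /D /P /R !antiperD !(antiper_lt _ _ k) //=; ring. Qed.

(** The index [j + n.-1] stands for [j - 1] within [nat], at the cost of a sign. *)
Lemma gon_det_pred j : (j < n)%N -> D j (j + n.-1) = 1.
Proof.
move=> j_n; rewrite -(gon_det_succ2 (j + n.-1)%N) ?ltn_add2r //.
have -> : (j + n.-1).+1 = (j + n)%N by lia.
by rewrite gon_detDr // /D; ring.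
Qed.

Lemma gon_neighbours j : (j < n)%N ->
  #|[set k : 'I_n | (k != j :> nat) && farey_edge (v k) (v j)]| =
  (\sum_(k < n.-1) (D j (j.+1 + k) == 1))%N.
Proof.
move=> j_n; pose G k : nat := `|D j k| == 1.
have GDn k : (k < n)%N -> G (k + n)%N = G k.
  by move=> k_n; rewrite /G gon_detDr // normrN.
have Gj : G j = 0%N by rewrite /G /D subrr normr0.
transitivity (\sum_(0 <= k < n) G k)%N.
  rewrite big_mkord cardsE -sum1_card big_mkcond; apply: eq_bigr => k _.
  rewrite unfold_in /= /G /D /P /R !antiper_lt //= /farey_edge /farey_dist.
  rewrite distrC; case: (eqVneq (k : nat) j) => [-> | _] /=.
    by rewrite subrr normr0.
  by case: eqP.
(* The absolute value makes [G] periodic, so the sum may start at [j]; from there on the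
   determinants are positive. *)
transitivity (\sum_(j <= k < j + n) G k)%N.
  rewrite (@big_cat_nat _ _ _ j) //=; last exact: ltnW.
  rewrite [RHS](@big_cat_nat _ _ _ n) ?leq_addl //=; last exact: ltnW.
  rewrite addnC; congr addn.
  have -> : (\sum_(n <= k < j + n) G k = \sum_(0 <= k < j) G (k + n))%N.
    by rewrite -{1}(add0n n) big_addn addnK.
  rewrite !big_mkord.
  by apply: eq_bigr => k _; rewrite GDn // (ltn_trans (ltn_ord k)).
rewrite big_ltn ?Gj ?add0n; last lia.
rewrite -{1}(add0n j.+1) big_addn.
have -> : (j + n - j.+1)%N = n.-1 by lia.
rewrite big_mkord; apply: eq_bigr => k _; rewrite addnC /G gtr0_norm //.
by apply: gon_det_gt0 => //; have := ltn_ord k; lia.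
Qed.

Lemma gon_triangles j : (j < n)%N ->
  farey_triangles n v j = - D (j + n.-1) j.+1.
Proof.
move=> j_n; rewrite /farey_triangles gon_neighbours //.
have n1 : n.-2.+1 = n.-1 by lia.
have last_j : (j.+1 + n.-2 = j + n.-1)%N by lia.
(* The last term is the neighbour [j - 1]; it cancels the [- 1] in [farey_triangles]. *)
rewrite -n1 big_ord_recr /= n1 last_j gon_det_pred // eqxx /= PoszD addrK.
(* Both end denominators are 1; the first numerator is the claimed value and the last is 0. *)
have := farey_path_count n.-2 (fun k => D j (j.+1 + k))
  (fun k => - D (j + n.-1) (j.+1 + k)).
rewrite /= addn0 last_j gon_det_pred // gon_det_succ // !divz1.
have -> : D (j + n.-1) (j + n.-1) = 0 by rewrite /D subrr.
rewrite oppr0 add0r => -> // k k_n.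
  by apply: gon_det_gt0; lia.
(* By the Plücker identity, the determinant of a path step is this product. *)
have key : D j (j + n.-1) * D (j.+1 + k) (j.+1 + k).+1 = 1.
  by rewrite gon_det_pred // gon_det_succ2 //; lia.
by rewrite -key addnS /D; ring.
Qed.

(** This is the linear relation between three plane vectors, two of whose coefficients are unit
    determinants. *)
Lemma gon_rec_num j : (j < n)%N ->
  P j.+1 = farey_triangles n v j * P j + P (j + n.-1)%N.
Proof.
move=> j_n; rewrite gon_triangles //.
rewrite -[LHS]mul1r -[X in _ = _ + X]mul1r.
by rewrite -{1}(gon_det_pred _ j_n) -(gon_det_succ _ j_n) /D; ring.
Qed.

Lemma gon_rec_den j : (j < n)%N ->
  R j.+1 = farey_triangles n v j * R j + R (j + n.-1)%N.
Proof.
move=> j_n; rewrite gon_triangles //.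
rewrite -[LHS]mul1r -[X in _ = _ + X]mul1r.
by rewrite -{1}(gon_det_pred _ j_n) -(gon_det_succ _ j_n) /D; ring.
Qed.

End FareyGon.


(** * From the polygons to the array *)

(** The determinant is a Bezout relation, so the fraction is already reduced. *)
Lemma qinf_num_den_frac (x y s t : int) : 0 < y -> x * t - s * y = 1 ->
  qinf_num (Some (x%:~R / y%:~R)) = x /\ qinf_den (Some (x%:~R / y%:~R)) = y.
Proof.
move=> y_gt0 det1.
have co : coprime `|x| `|y|.
  rewrite -/(coprimez x y); apply/coprimezP; exists (t, - s).
  by rewrite /= -det1; ring.
by rewrite /= coprimeq_num // coprimeq_den // gtr0_sg // mul1r gtr0_norm //
  (negbTE (lt0r_neq0 _)).
Qed.

Theorem theorem7p1 (n m : nat) (hn : (2 <= n)%N) (hm : (2 <= m)%N)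
  (a : int -> int -> int)
  (a_det : forall i j : int,
     a i j * a (i + 1) (j + 1) - a i (j + 1) * a (i + 1) j = 1)
  (a_antiperiodic_col : forall i j : int, a i (j + n%:Z) = - a i j)
  (a_antiperiodic_row : forall i j : int, a (i + m%:Z) j = - a i j)
  (a_pos : forall i j : nat, (i < m)%N -> (j < n)%N -> 0 < a i%:Z j%:Z)
  (q q' : int -> int)
  (q_periodic : forall j : int, q (j + n%:Z) = q j)
  (q'_periodic : forall i : int, q' (i + m%:Z) = q' i)
  (a_rec_col : forall i j : int, a i (j + 1) = q j * a i j - a i (j - 1))
  (a_rec_row : forall i j : int, a (i + 1) j = q' i * a i j - a (i - 1) j)
  (v : nat -> qinf)
  (v_gon : farey_gon n v)
  (v_0 : v 0%N = Some ((a 0 0)%:~R / (a 1 0)%:~R))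
  (v_1 : v 1%N = Some ((a 0 1)%:~R / (a 1 1)%:~R))
  (v_triangles : forall j : nat, (j < n)%N -> farey_triangles n v j = q j%:Z)
  (v' : nat -> qinf)
  (v'_gon : farey_gon m v')
  (v'_0 : v' 0%N = None)
  (v'_last : v' m.-1 = Some 0)
  (v'_triangles : forall i : nat, (i < m)%N ->
     farey_triangles m v' i = q' (i%:Z + 1)) :
  forall i j : nat, (i < m)%N -> (j < n)%N ->
    a i%:Z j%:Z = farey_dist (v' (if i == 0%N then m.-1 else i.-1)) (v j).
Proof.
have det00 : a 0 0 * a 1 1 - a 0 1 * a 1 0 = 1 by have := a_det 0 0; rewrite !add0r.
have [num0 den0] : qinf_num (v 0%N) = a 0 0 /\ qinf_den (v 0%N) = a 1 0.
  by rewrite v_0; apply: qinf_num_den_frac det00; apply: (a_pos 1%N 0%N) => //; lia.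
have [num1 den1] : qinf_num (v 1%N) = a 0 1 /\ qinf_den (v 1%N) = a 1 1.
  rewrite v_1; apply: (qinf_num_den_frac _ _ (- a 0 0) (- a 1 0)).
    exact: (a_pos 1%N 1%N).
  by rewrite -[RHS]det00; ring.
have rec2 i (j : nat) : a i j.+2%:Z = q j.+1%:Z * a i j.+1%:Z - a i j%:Z.
  have := a_rec_col i j.+1%:Z.
  have -> : j.+1%:Z + 1 = j.+2%:Z by lia.
  by have -> : j.+1%:Z - 1 = j%:Z by lia.
have row2 (i : nat) j : a i.+2%:Z j = q' i.+1%:Z * a i.+1%:Z j - a i%:Z j.
  have := a_rec_row i.+1%:Z j.
  have -> : i.+1%:Z + 1 = i.+2%:Z by lia.
  by have -> : i.+1%:Z - 1 = i%:Z by lia.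
have pred_shift (N k : nat) : (k.+2 < N)%N -> (k.+1 + N.-1 = k + N)%N by lia.
(* The recurrence has order two, so the induction carries two consecutive columns. *)
have cols j : (j.+1 < n)%N ->
  [/\ qinf_num (v j) = a 0 j%:Z, qinf_den (v j) = a 1 j%:Z,
      qinf_num (v j.+1) = a 0 j.+1%:Z & qinf_den (v j.+1) = a 1 j.+1%:Z].
  elim: j => [|j IHj] j_n; first by split.
  have [IHnum IHden IHnumS IHdenS] := IHj (ltnW j_n).
  have := gon_rec_num _ _ hn v_gon _ (ltnW j_n).
  have := gon_rec_den _ _ hn v_gon _ (ltnW j_n).
  rewrite pred_shift // !antiperD !antiper_lt ?(ltnW j_n) //=.
  rewrite v_triangles ?(ltnW j_n) // IHnum IHden IHnumS IHdenS -!rec2.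
  by move=> -> ->.
have col j : (j < n)%N -> qinf_num (v j) = a 0 j%:Z /\ qinf_den (v j) = a 1 j%:Z.
  case: j => [|j] j_n; first by split.
  by have [] := cols j j_n.
move=> i j i_m j_n; have [numj denj] := col j j_n.
(* Row [k.+1] belongs to [v' k]. In the base case the predecessor of [v' 0] is the last vertex 0/1,
   with no sign change. *)
have rows k : (k.+1 < m)%N -> a k.+1%:Z j%:Z = qinf_det (v' k) (v j)
    /\ ((k.+2 < m)%N -> a k.+2%:Z j%:Z = qinf_det (v' k.+1) (v j)).
  elim: k => [|k IHk] k_m.
    split; first by rewrite /qinf_det v'_0 /= mul1r mulr0 subr0 denj.
    move=> m_gt2; have := gon_rec_num _ _ hm v'_gon _ (ltnW hm).
    have := gon_rec_den _ _ hm v'_gon _ (ltnW hm).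
    rewrite add0n !antiper_lt ?prednK //=; try lia.
    rewrite v'_triangles ?add0r ?v'_0 ?v'_last //=; last lia.
    rewrite row2 /qinf_det => -> ->; rewrite numj denj.
    have -> : numq 0 = 0 by [].
    have -> : denq 0 = 1 by [].
    by ring.
  have [IHa /(_ k_m) IHb] := IHk (ltnW k_m); split => // k_m2.
  have := gon_rec_num _ _ hm v'_gon _ (ltnW k_m).
  have := gon_rec_den _ _ hm v'_gon _ (ltnW k_m).
  rewrite pred_shift // !antiperD !antiper_lt ?(ltnW k_m) //=.
  rewrite v'_triangles ?(ltnW k_m) //.
  have -> : k.+1%:Z + 1 = k.+2%:Z by lia.
  by rewrite row2 IHa IHb /qinf_det => -> ->; ring.
have a_gt0 := a_pos i j i_m j_n.
(* For row 0 the determinant with 0/1 is [- a 0 j]; the absolute value removes the sign. *)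
rewrite -[LHS]gtr0_norm // /farey_dist; case: i => [|i] /= in i_m a_gt0 *.
  by rewrite v'_last /= -numj mul0r mulr1 sub0r normrN.
by have [-> _] := rows i i_m.
Qed.
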